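(* Let $J=J_1\oplus J_2\oplus\dots\oplus J_r$ be an $n\times n$ complex matrix in Jordan form, where $J_i$ is a Jordan cell of dimension $n_i$ with non-zero eigenvalue $\lambda_i$, $1\le i\le r$, $n=n_1+\dots+n_r$. Let $A=(a_{ij})_{1\le i,j\le n}$ be the matrix (in a natural basis) of an evolution algebra isomorphic to the evolution algebra whose matrix in some natural basis is $J$. Then, for some permutation $\pi\in S_n$, the only non-zero elements of $A$ are the diagonal elements and the elements $a_{i,s'_\pi(i)}$, and these satisfy $$\frac{a_{ii}^2}{a_{i,s'_\pi(i)}\,a_{s'_\pi(i)s'_\pi(i)}}=\frac{\mu_i^2}{\mu_{s'_\pi(i)}}\qquad\text{for } i\notin\{\pi^{-1}(m_1),\dots,\pi^{-1}(m_r)\}.$$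
   Context: An evolution algebra over a field $K$ is a vector space $E$ over $K$ with a bilinear multiplication and a basis $\{e_1,e_2,\dots\}$ (called a natural basis) such that $e_ie_j=0$ for $i\neq j$ and $e_ie_i=\sum_k a_{ik}e_k$; here $K=\mathbb{C}$. The matrix $A=(a_{ij})_{i,j=1}^n$ is called the matrix of $E$ in the natural basis $\{e_1,\dots,e_n\}$. A Jordan cell with eigenvalue $\lambda$ has $\lambda$ on the diagonal, $1$ on the superdiagonal and $0$ elsewhere. Put $m_i=n_1+\dots+n_i$ and $m_0=0$. Define $\mu_k=\lambda_i$ for $m_{i-1}+1\le k\le m_i$, $1\le i\le r$. For $\pi\in S_n$, $s'_\pi:\{1,\dots,n\}\setminus\{\pi^{-1}(m_1),\dots,\pi^{-1}(m_r)\}\to\{1,\dots,n\}$ is the one-to-one map $s'_\pi(i)=\pi^{-1}(1+\pi(i))$.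
   Formalization: The right-hand side is corrected from μ_i²/μ_{s'_π(i)} to μ_{π(i)}²/μ_{π(s'_π(i))}; as printed it fails for cells of sizes 2, 1 with eigenvalues 1, 2 after exchanging the first and third basis vectors. *)

(* Defs.v *)
From HB Require Import structures.
From mathcomp Require Import all_boot all_order all_algebra fingroup perm.
From mathcomp Require Import complex reals.

Set Implicit Arguments.
Unset Strict Implicit.
Unset Printing Implicit Defensive.

Import Order.TTheory GRing.Theory Num.Theory.
Local Open Scope ring_scope.

Section EvolutionAlgebra.
Variable K : fieldType.

(* A natural basis: e_i e_j = 0 for i <> j. The products e_i e_i are then     *)
(* arbitrary; their coordinates are the rows of the matrix of the algebra.    *)
Definition natural_basis (V : vectType K) (mul : V -> V -> V)
    (n : nat) (e : n.-tuple V) : Prop :=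
  basis_of fullv e /\ (forall i j : 'I_n, i != j -> mul e`_i e`_j = 0).

Record evolution_algebra := EvolutionAlgebra {
  ev_carrier :> vectType K;
  ev_mul : {bilinear ev_carrier -> ev_carrier -> ev_carrier};
  ev_natural : exists (n : nat) (e : n.-tuple ev_carrier),
    natural_basis ev_mul e
}.

(* A is the matrix of E in some natural basis: row i holds the coordinates of *)
(* e_i e_i.                                                                   *)
Definition has_matrix (E : evolution_algebra) (n : nat) (A : 'M[K]_n) : Prop :=
  exists e : n.-tuple E,
    natural_basis (ev_mul E) e /\
    (forall i : 'I_n, ev_mul E e`_i e`_i = \sum_(k < n) A i k *: e`_k).

Definition ev_isomorphic (E F : evolution_algebra) : Prop :=
  exists f : {linear E -> F},
    bijective f /\ (forall x y : E, f (ev_mul E x y) = ev_mul F (f x) (f y)).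

End EvolutionAlgebra.

Section Jordan.
Variables (K : fieldType) (r : nat) (n_ : 'I_r -> nat) (lambda : 'I_r -> K).

Definition jordan_cell (n : nat) (a : K) : 'M[K]_n :=
  \matrix_(i, j) (a *+ (i == j) + (j == i.+1 :> nat)%:R).

Definition jordan_mx : 'M[K]_(\sum_i n_ i) :=
  \mxdiag_(i < r) jordan_cell (n_ i) (lambda i).

(* Blocks are numbered from 0 here, so m_ i is the sum of the sizes of the    *)
(* first i blocks, and block i occupies the indices m_ i <= k < m_ i.+1.      *)
Definition m_ (i : nat) : nat := (\sum_(j < r | j < i) n_ j)%N.

(* tagnat.sig1 k is the number of the block that contains the index k.        *)
(* mu is indexed by the rows of J, not by the rows of the matrix A of the     *)
(* isomorphic algebra: row i of A corresponds to mu (pi i). With mu i instead *)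
(* the ratio formula fails, e.g. for cells of sizes 2, 1 with eigenvalues     *)
(* 1, 2 after exchanging the basis vectors 1 and 3.                           *)
Definition mu (k : 'I_(\sum_i n_ i)) : K := lambda (tagnat.sig1 k).

Lemma muE (i : 'I_r) (k : 'I_(\sum_i n_ i)) :
  (m_ i <= k < m_ i.+1)%N -> mu k = lambda i.
Proof.
have mono a b : (a <= b)%N -> (m_ a <= m_ b)%N.
  move=> ab; rewrite /m_ big_mkcond [X in (_ <= X)%N]big_mkcond /=.
  apply: leq_sum => j _; case: ifP => // ja.
  by rewrite (leq_trans ja ab).
have mS (j : 'I_r) : m_ j.+1 = (m_ j + n_ j)%N.
  rewrite /m_ (bigD1 j) //= addnC; congr (_ + _)%N.
  by apply: eq_bigl => l; rewrite ltnS ltn_neqAle andbC.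
have := tagnat.rect k; rewrite -/(m_ _) => kE /andP[ik ki].
suff -> : i = tagnat.sig1 k by [].
apply/val_inj/eqP; rewrite eqn_leq; apply/andP; split; rewrite leqNgt /=.
  apply/negP => lt; have := mono _ _ lt; rewrite mS => le.
  have := leq_trans le ik; rewrite kE leq_add2l leqNgt.
  by rewrite ltn_ord.
apply/negP => lt; have := leq_trans ki (mono _ _ lt).
by rewrite kE ltnNge leq_addr.
Qed.

(* The indices pi^-1(m_1), ..., pi^-1(m_r) that end a block after             *)
(* relabelling; counting indices from 0, the last index of block i is         *)
(* m_ i.+1 - 1.                                                               *)
Definition block_ends (pi : 'S_(\sum_i n_ i)) : {set 'I_(\sum_i n_ i)} :=
  [set i | [exists b : 'I_r, (pi i).+1 == m_ b.+1]].

End Jordan.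

(* s'_pi(i) = pi^-1(1 + pi(i)). ordS wraps around at the last index, but that *)
(* index is m_r, which is outside the domain of s'_pi.                        *)
Definition s' (n : nat) (pi : 'S_n) (i : 'I_n) : 'I_n := (pi^-1)%g (ordS (pi i)).

(* Main.v *)
Require Import Defs.
From HB Require Import structures.
From mathcomp Require Import all_boot all_order all_algebra fingroup perm.
From mathcomp Require Import complex reals.

Import Order.TTheory GRing.Theory Num.Theory.
Local Open Scope ring_scope.

(** An isomorphism carries a natural basis with matrix [J] to a natural basis
    with matrix [J], so the question is how two natural bases [e] (with matrix
    [J]) and [g] (with matrix [A]) of one algebra are related. Write
    [g_i = \sum_k P_ik e_k]. For [i != j], [0 = g_i g_j] is the combination of
    the squares [e_k e_k] with coefficients [P_ik P_jk]; since [J] is invertible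
    these squares are linearly independent, so distinct rows of [P] have
    disjoint supports. No row of [P] vanishes, hence [P] is a monomial matrix:
    [g_i = c_i e_(s i)] for a permutation [s] and non-zero scalars [c_i].
    Comparing squares gives [A_ij = c_i ^ 2 / c_j * J_(s i)(s j)]
    ([natural_basis_change]).

    For [J] in Jordan form without zero eigenvalue, [J] is upper triangular with
    non-zero diagonal, hence invertible. With [pi = s], the entries
    [c_i ^ 2 / c_j * J_(pi i)(pi j)] have the zero pattern of [J] transported by
    [pi] ([jordan_mxE]), and the scalars cancel from the ratio. *)

Section NaturalBases.
Set Implicit Arguments.
Unset Strict Implicit.

Variable K : fieldType.

Lemma has_matrix_isomorphic (E F : evolution_algebra K) (n : nat)
    (A : 'M[K]_n) :
  ev_isomorphic E F -> has_matrix E A -> has_matrix F A.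
Proof.
case=> f [[f' fK f'K] fM] [e [[e_basis e_orth] e_sq]].
have fe (i : 'I_n) : (map_tuple f e)`_i = f e`_i.
  by rewrite (nth_map 0) ?size_tuple.
exists (map_tuple f e); split; last first.
  move=> i; rewrite fe -fM e_sq linear_sum.
  by apply: eq_bigr => k _; rewrite linearZ fe.
split; last by move=> i j ij; rewrite !fe -fM e_orth // linear0.
have f_lker : lker (linfun f) == 0%VS.
  by apply/lker0P => x y; rewrite !lfunE => /(can_inj fK).
have f_full : (linfun f @: fullv = fullv)%VS.
  apply/eqP; rewrite eqEsubv subvf; apply/subvP => y _.
  by rewrite -[y]f'K -[f _]lfunE memv_img ?memvf.
rewrite -f_full.
have -> : map_tuple f e = map (linfun f) e :> seq F.
  by apply: eq_map => x; rewrite lfunE.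
by apply: limg_basis_of; rewrite // (eqP f_lker) capv0.
Qed.

(** The natural basis of an algebra whose matrix is invertible is unique up to
    reordering and rescaling; this is the effect on the matrix. *)
Lemma natural_basis_change (E : evolution_algebra K) (n : nat)
    (J A : 'M[K]_n) :
  J \in unitmx -> has_matrix E J -> has_matrix E A ->
  exists (s : 'S_n) (c : 'I_n -> K),
    (forall i, c i != 0) /\
    (forall i j, A i j = c i ^+ 2 / c j * J (s i) (s j)).
Proof.
move=> J_unit [e [[e_basis e_orth] e_sq]] [g [[g_basis g_orth] g_sq]].
have [e_free g_free] := (basis_free e_basis, basis_free g_basis).
pose P (i k : 'I_n) := coord e k g`_i.
have gE (i : 'I_n) : g`_i = \sum_k P i k *: e`_k.
  exact: coord_basis e_basis (memvf _).
have mul_coord (a b : 'I_n -> K) :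
    ev_mul E (\sum_k a k *: e`_k) (\sum_k b k *: e`_k) =
    \sum_l (\sum_k a k * b k * J k l) *: e`_l.
  rewrite linear_sumlz.
  transitivity (\sum_k (a k * b k) *: ev_mul E e`_k e`_k).
    apply: eq_bigr => k _; rewrite linear_sumr (bigD1 k) //= big1 ?addr0.
      by rewrite linearZl_LR linearZr_LR /= scalerA.
    move=> l lk; rewrite linearZl_LR linearZr_LR /=.
    by rewrite e_orth ?scaler0 // eq_sym.
  under eq_bigr do rewrite e_sq scaler_sumr.
  rewrite exchange_big; apply: eq_bigr => l _; rewrite scaler_suml.
  by apply: eq_bigr => k _; rewrite scalerA.
have P_disjoint (i j : 'I_n) : i != j -> forall k, P i k * P j k = 0.
  move=> ij k; pose v := \row_k (P i k * P j k).
  suff v0 : v = 0 by have /rowP/(_ k) := v0; rewrite !mxE.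
  suff vJ : v *m J = 0 by rewrite -[v](mulmxK J_unit) vJ mul0mx.
  apply/rowP => l; rewrite !mxE.
  have := g_orth _ _ ij; rewrite !gE mul_coord.
  move=> /(elimT freeP e_free)/(_ l) vJ0.
  by rewrite -[RHS]vJ0; apply: eq_bigr => m _; rewrite mxE.
have P_row (i : 'I_n) : exists k, P i k != 0.
  apply/existsP; apply: contraT; rewrite negb_exists => /forallP P0.
  have : g`_i != 0 by rewrite (free_not0 g_free) // mem_nth ?size_tuple.
  by rewrite gE big1 ?eqxx // => k _; rewrite (eqP (negPn (P0 k))) scale0r.
pose s0 i := xchoose (P_row i).
have s0P i : P i (s0 i) != 0 := xchooseP (P_row i).
have s0_inj : injective s0.
  move=> i j eq_s; apply/eqP; apply: contraT => /P_disjoint/(_ (s0 i))/eqP.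
  by rewrite {2}eq_s mulf_eq0 (negPf (s0P i)) (negPf (s0P j)).
pose s := perm s0_inj; pose c i := P i (s i).
have c_neq0 i : c i != 0 by rewrite /c permE s0P.
(* Column [k] already has a non-zero entry in row [s^-1 k], hence no other. *)
have P_off (i k : 'I_n) : k != s i -> P i k = 0.
  rewrite -[k](permKV s); set j := (s^-1)%g k => ji.
  have /P_disjoint/(_ (s j))/eqP : i != j by apply: contraNneq ji => ->.
  by rewrite mulf_eq0 (negPf (c_neq0 j)) orbF => /eqP.
have ge (i : 'I_n) : g`_i = c i *: e`_(s i).
  rewrite gE (bigD1 (s i)) //= big1 ?addr0 // => k ki.
  by rewrite P_off ?scale0r.
exists s, c; split=> // i j.
rewrite -(coord_sum_free (A i) j g_free) -g_sq.
suff -> : ev_mul E g`_i g`_i =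
    \sum_(l < n) (c i ^+ 2 / c l * J (s i) (s l)) *: g`_l.
  by rewrite coord_sum_free.
rewrite ge linearZl_LR linearZr_LR /= e_sq scalerA -expr2 scaler_sumr.
rewrite (reindex_inj (@perm_inj _ s)); apply: eq_bigr => l _.
by rewrite ge !scalerA [X in _ = X *: _]mulrAC divfK.
Qed.

End NaturalBases.

Section JordanEntries.
Set Implicit Arguments.
Unset Strict Implicit.

Variables (K : fieldType) (r : nat) (n_ : 'I_r -> nat) (lambda : 'I_r -> K).

Local Notation N := (\sum_i n_ i)%N.

Lemma m_S (i : 'I_r) : m_ n_ i.+1 = (m_ n_ i + n_ i)%N.
Proof.
rewrite /m_ (bigD1 i) //= addnC; congr (_ + _)%N.
by apply: eq_bigl => l; rewrite ltnS ltn_neqAle andbC.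
Qed.

Lemma leq_m_ (a b : nat) : (a <= b)%N -> (m_ n_ a <= m_ n_ b)%N.
Proof.
move=> ab; rewrite /m_ big_mkcond [leqRHS]big_mkcond /=.
by apply: leq_sum => j _; case: ifP => // ja; rewrite (leq_trans ja ab).
Qed.

(** [tagnat.Rank i a] is the index at offset [a] in block [i]. *)
Lemma Rank_m_ (i : 'I_r) (a : 'I_(n_ i)) :
  tagnat.Rank i a = (m_ n_ i + a)%N :> nat.
Proof. exact: tagnat.RankEsum. Qed.

Lemma RankP (k : 'I_N) : exists (i : 'I_r) (a : 'I_(n_ i)), k = tagnat.Rank i a.
Proof. by exists (tagnat.sig1 k), (tagnat.sig2 k); rewrite tagnat.sig2K. Qed.

(** An empty block ends where its predecessor ends, so it adds no block end. *)
Lemma mem_block_ends (pi : 'S_N) (k : 'I_N) (i : 'I_r) (a : 'I_(n_ i)) :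
  pi k = tagnat.Rank i a -> (k \in block_ends pi) = (a.+1 == n_ i).
Proof.
move=> pik; rewrite inE pik Rank_m_ -addnS.
apply/existsP/eqP => [[b /eqP eq_b] | eq_a]; last first.
  by exists i; rewrite m_S eq_a.
have le_ib : (i <= b)%N.
  rewrite leqNgt; apply/negP => /leq_m_.
  by rewrite -eq_b leqNgt addnS ltnS leq_addr.
apply/eqP; rewrite eqn_leq ltn_ord /= -(leq_add2l (m_ n_ i)) -m_S eq_b.
exact: leq_m_.
Qed.

(** Off the block ends the cyclic successor does not wrap around. *)
Lemma val_ordS_block (pi : 'S_N) (k : 'I_N) :
  k \notin block_ends pi -> ordS (pi k) = (pi k).+1 :> nat.
Proof.
have [i [a pik]] := RankP (pi k); rewrite (mem_block_ends pik) => a_end.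
have lt_a : (a.+1 < n_ i)%N by rewrite ltn_neqAle a_end ltn_ord.
rewrite /= modn_small // pik.
have -> : (tagnat.Rank i a).+1 = tagnat.Rank i (Ordinal lt_a).
  by rewrite !Rank_m_ addnS.
exact: ltn_ord.
Qed.

(** The superdiagonal entry at a row that ends a block is 0, and no other entry
    joins two blocks. Rows and columns are relabelled by [pi] because block ends
    are defined relative to a permutation. *)
Lemma jordan_mxE (pi : 'S_N) (k l : 'I_N) :
  jordan_mx n_ lambda (pi k) (pi l) =
  mu lambda (pi k) *+ (k == l) +
  ((pi l == (pi k).+1 :> nat) && (k \notin block_ends pi))%:R.
Proof.
rewrite -(inj_eq (@perm_inj _ pi) k l).
have [i [a pik]] := RankP (pi k); have [j [b pil]] := RankP (pi l).
rewrite (mem_block_ends pik) pik pil.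
rewrite -[tagnat.Rank i a == _]val_eqE tagnat.eq_Rank !Rank_m_.
rewrite /mu tagnat.Rank1K.
transitivity (submxblock (jordan_mx n_ lambda) i j a b).
  by rewrite [RHS]mxE.
have [eq_ij | neq_ij] /= := eqVneq i j.
  case: j / eq_ij b {pil} => b; rewrite submxblock_diag mxE -addnS eqn_add2l.
  congr (_ + _%:R); case: eqP => //= eq_b.
  by rewrite neq_ltn -eq_b ltn_ord.
rewrite mxblockK (negPf neq_ij) mxE mulr0n add0r.
case: eqP => //= eq_b; case: (eqVneq a.+1 (n_ i)) => //= neq_a; exfalso.
move: eq_b; case: (ltngtP i j) => [lt_ij | lt_ji | /val_inj/eqP]; last first.
- by rewrite (negPf neq_ij).
- have := leq_m_ lt_ji; rewrite m_S => le_m eq_b.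
  have : (m_ n_ j + b < m_ n_ i)%N by rewrite (leq_trans _ le_m) // ltn_add2l.
  by rewrite eq_b ltnNge ltnW // ltnS leq_addr.
have := leq_m_ lt_ij; rewrite m_S => le_m eq_b.
have : (m_ n_ i + n_ i <= (m_ n_ i + a).+1)%N.
  by rewrite -eq_b (leq_trans le_m) // leq_addr.
by rewrite -addnS leq_add2l leqNgt ltn_neqAle neq_a ltn_ord.
Qed.

Lemma jordan_mx_unit :
  (forall i, lambda i != 0) -> jordan_mx n_ lambda \in unitmx.
Proof.
move=> lambda_neq0.
have JE k l := jordan_mxE 1%g k l.
rewrite unitmxE -det_tr det_trig; last first.
  apply/is_trig_mxP => k l lt_kl; rewrite [LHS]mxE.
  have := JE l k; rewrite !perm1 => ->.
  rewrite -[l == k]val_eqE gtn_eqF // mulr0n add0r.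
  by rewrite ltn_eqF // (ltn_trans lt_kl).
rewrite unitfE; apply/prodf_neq0 => k _; rewrite [_ k k]mxE.
have := JE k k; rewrite !perm1 => ->.
by rewrite eqxx (ltn_eqF (ltnSn _)) addr0 lambda_neq0.
Qed.

End JordanEntries.

Theorem corollary3p3 (R : realType) (r : nat) (n_ : 'I_r -> nat)
    (lambda : 'I_r -> complex R)
    (n_gt0 : forall i : 'I_r, (0 < n_ i)%N)
    (lambda_neq0 : forall i : 'I_r, lambda i != 0)
    (E F : evolution_algebra (complex R))
    (A : 'M[complex R]_(\sum_i n_ i))
    (hE : has_matrix E (jordan_mx n_ lambda))
    (hF : has_matrix F A)
    (hEF : ev_isomorphic E F) :
  exists pi : 'S_(\sum_i n_ i),
    (forall i j : 'I_(\sum_i n_ i),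
       A i j != 0 <->
       i = j \/ (i \notin block_ends pi /\ j = s' pi i)) /\
    (forall i : 'I_(\sum_i n_ i), i \notin block_ends pi ->
       A i i ^+ 2 / (A i (s' pi i) * A (s' pi i) (s' pi i)) =
       mu lambda (pi i) ^+ 2 / mu lambda (pi (s' pi i))).
Proof.
have hJ := has_matrix_isomorphic hEF hE.
have [pi [c [c_neq0 AE]]] :=
  natural_basis_change (jordan_mx_unit n_ lambda_neq0) hJ hF.
have mu_neq0 (k : 'I_(\sum_i n_ i)) : mu lambda k != 0 by exact: lambda_neq0.
have diagE i : A i i = c i * mu lambda (pi i).
  rewrite AE jordan_mxE eqxx (ltn_eqF (ltnSn _)) addr0.
  by rewrite expr2 mulfK.
have val_pi_s' i : i \notin block_ends pi -> pi (s' pi i) = (pi i).+1 :> nat.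
  by move=> i_end; rewrite permKV; apply: val_ordS_block i_end.
have s'_neq i : i \notin block_ends pi -> (i == s' pi i) = false.
  move=> i_end; apply/eqP => eq_i; have := val_pi_s' i i_end.
  by rewrite -eq_i => /eqP; rewrite ltn_eqF.
have succE i : i \notin block_ends pi -> A i (s' pi i) = c i ^+ 2 / c (s' pi i).
  move=> i_end; rewrite AE jordan_mxE s'_neq // val_pi_s' // eqxx i_end.
  by rewrite add0r mulr1.
exists pi; split=> [i j | i i_end]; last first.
  have := (c_neq0 i, c_neq0 (s' pi i), mu_neq0 (pi i), mu_neq0 (pi (s' pi i))).
  rewrite succE // !diagE => -[[[ci_neq0 cs_neq0] mui_neq0] mus_neq0].
  rewrite mulrA divfK // exprMn.
  by rewrite -mulf_div divff ?mul1r // expf_neq0.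
split=> [|[<- | [i_end ->]]]; first last.
- by rewrite succE // mulf_neq0 ?expf_neq0 ?invr_neq0.
- by rewrite diagE mulf_neq0.
rewrite AE jordan_mxE; case: (eqVneq i j) => [-> | _]; first by left.
rewrite add0r; case: (pi j =P (pi i).+1 :> nat) => [eq_j | _]; last first.
  by rewrite mulr0 eqxx.
case: (boolP (i \in block_ends pi)) => [_ | i_end _].
  by rewrite mulr0 eqxx.
right; split=> //; apply: (@perm_inj _ pi); apply: val_inj.
by rewrite /= eq_j val_pi_s'.
Qed.
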